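(* Let $E$ be a complex finite dimensional vector space and let $L$ be a complex nilpotent Lie subalgebra of $\mathcal{L}(E)^{op}$. Then $$Sp(L,E)=\{\alpha\in L^*\colon \alpha \text{ is a weight of } L \text{ for } E\}.$$
   Context: $\mathcal{L}(E)$ is the algebra of all linear transformations of $E$, and $\mathcal{L}(E)^{op}$ is the same vector space with the opposite product, regarded as a Lie algebra with its commutator bracket; thus $[x,y]=yx-xy$ in terms of ordinary composition. $L^*$ is the dual vector space of $L$. For $e\in E$ and $x\in L$ write $e\cdot x:=x(e)$. Let $n=\dim L$. A character of $L$ is an $f\in L^*$ with $f([x,y])=0$ for all $x,y\in L$. For a character $f$, $(E\otimes\wedge L,d(f))$ is the chain complex with maps $d_p(f)\colon E\otimes\wedge^pL\to E\otimes\wedge^{p-1}L$, $$d_p(f)\big(e\otimes x_1\wedge\dots\wedge x_p\big)=\sum_{k=1}^p(-1)^{k+1}\big(e\cdot x_k-f(x_k)e\big)\otimes x_1\wedge\dots\wedge\hat{x_k}\wedge\dots\wedge x_p+\sum_{1\le k<l\le p}(-1)^{k+l}e\otimes[x_k,x_l]\wedge x_1\wedge\dots\wedge\hat{x_k}\wedge\dots\wedge\hat{x_l}\wedge\dots\wedge x_p$$ for $1\le p\le n$ (where $\hat{\ }$ means deletion), and $d_p(f)=0$ if $p\le 0$ or $p\ge n+1$. Its homology is $H_p(E\otimes\wedge L,d(f))=\ker d_p(f)/\operatorname{im} d_{p+1}(f)$. The joint spectrum is $Sp(L,E)=\{f\in L^*\colon f \text{ is a character of } L \text{ and } H_p(E\otimes\wedge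 L,d(f))\neq0 \text{ for some } p\}$. A weight of $L$ for $E$ is a map $\alpha\colon L\to\mathbb{C}$ for which there is a nonzero vector $v\in E$ such that for every $x\in L$ there is $m_{v,x}\in\mathbb{N}$ with $(x-\alpha(x))^{m_{v,x}}(v)=0$. *)

(* Defs.v *)
From HB Require Import structures.
From mathcomp Require Import all_boot all_order all_algebra.
From mathcomp Require Import complex boolp classical_sets reals.

Set Implicit Arguments.
Unset Strict Implicit.
Unset Printing Implicit Defensive.

Import GRing.Theory.
Local Open Scope ring_scope.

Section OppositeLie.
Variables (F : fieldType) (E : vectType F).

(* The commutator of x and y in the opposite algebra of 'End(E). *)
Definition op_bracket (x y : 'End(E)) : 'End(E) := ((y \o x) - (x \o y))%VF.

(* The span of all the brackets [x, y] with x in U and y in V. *)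
Definition bracketv (U V : {vspace 'End(E)}) : {vspace 'End(E)} :=
  <<[seq op_bracket x y | x <- vbasis U, y <- vbasis V]>>%VS.

Record lieSubalgebra := LieSubalgebra {
  lie_vspace :> {vspace 'End(E)};
  lie_closed : {in lie_vspace &, forall x y, op_bracket x y \in lie_vspace}
}.

Definition nilpotent_lie (L : lieSubalgebra) : Prop :=
  exists k, iter k (bracketv L) L = 0%VS.

End OppositeLie.

Section Koszul.
Variables (F : fieldType) (E : vectType F) (L : lieSubalgebra E).

Local Notation gL := (subvs_of L).
Local Notation n := (\dim {:gL}).
Local Notation b := (vbasis {:gL}).

Definition dual_lie := 'Hom(gL, F^o).

Definition lie_bracket (x y : gL) : gL :=
  Subvs (lie_closed (subvsP x) (subvsP y)).

Definition lie_character (f : dual_lie) : Prop :=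
  forall x y : gL, f (lie_bracket x y) = 0.

(* E (x) /\^p L, as the families of coefficients in E with respect to the     *)
(* basis b_(s_0) /\ ... /\ b_(s_(p-1)), s_0 < ... < s_(p-1), of /\^p L.       *)
Definition multi_index (p : nat) := {s : p.-tuple 'I_n | sorted ltn (map val s)}.

Definition chain (p : nat) := {ffun multi_index p -> E}.

(* e (x) (x_0 /\ ... /\ x_(p-1)) for xs = [:: x_0; ...; x_(p-1)]: the         *)
(* coefficients of x_0 /\ ... /\ x_(p-1) are the p x p minors of the matrix   *)
(* of coordinates of the x_j.                                                 *)
Definition wedge (p : nat) (e : E) (xs : seq gL) : chain p :=
  [ffun s : multi_index p =>
     \det (\matrix_(i < p, j < p) coord b (tnth (val s) i) xs`_j) *: e].

Definition omit (p : nat) (ks : seq 'I_p) (x : 'I_p -> gL) : seq gL :=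
  [seq x i | i <- enum 'I_p & i \notin ks].

(* d_(p+1)(f) (e (x) x_0 /\ ... /\ x_p). As the indices start from 0, the     *)
(* signs (-1)^(k+1) and (-1)^(k+l) of the 1-based formula are (-1)^k and      *)
(* (-1)^(k+l) here.                                                           *)
Definition koszul_wedge (f : dual_lie) (p : nat) (e : E) (x : 'I_p.+1 -> gL) :
    chain p :=
  \sum_(k < p.+1)
     (-1) ^+ k *: wedge p (vsval (x k) e - f (x k) *: e) (omit [:: k] x)
  + \sum_(k < p.+1) \sum_(l < p.+1 | (k < l)%N)
     (-1) ^+ (k + l) *:
       wedge p e (lie_bracket (x k) (x l) :: omit [:: k; l] x).

Definition koszul_fun (f : dual_lie) (p : nat) (c : chain p.+1) : chain p :=
  \sum_s koszul_wedge f (c s) (fun i => b`_(tnth (val s) i)).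

(* The target of d_0 should be the zero space; as d_0 = 0, chain 0 does as    *)
(* well. For p > \dim L the space chain p is zero.                            *)
Definition koszul (f : dual_lie) (p : nat) : 'Hom(chain p, chain p.-1) :=
  if p is q.+1 return 'Hom(chain p, chain p.-1) then linfun (@koszul_fun f q)
  else 0.

Definition boundary (f : dual_lie) (p : nat) :
    pred (subvs_of (lker (koszul f p))) :=
  fun z => vsval z \in limg (koszul f p.+1).

Fact boundary_zmod_closed f p : zmod_closed (@boundary f p).
Proof.
split=> [|u v Bu Bv].
  by change (vsval (0 : subvs_of (lker (koszul f p))) \in limg (koszul f p.+1));
     rewrite linear0 mem0v.
change (vsval (u - v) \in limg (koszul f p.+1)).
by rewrite linearB; apply: memvB Bu Bv.
Qed.
Definition boundary_zmodClosed f p : zmodClosed (subvs_of (lker (koszul f p))) :=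
  HB.pack (@boundary f p)
    (GRing.isZmodClosed.Build _ (@boundary f p) (@boundary_zmod_closed f p)).

Definition homology (f : dual_lie) (p : nat) : zmodType :=
  Quotient.quot (boundary_zmodClosed f p).

Definition joint_spectrum : set dual_lie :=
  [set f | lie_character f /\ exists p, exists h : homology f p, h != 0]%classic.

Definition lie_weight (alpha : gL -> F) : Prop :=
  exists2 v : E, v != 0 &
    forall x : gL, exists m : nat,
      iter m (fun w => vsval x w - alpha x *: w) v = 0.

End Koszul.
Arguments joint_spectrum {F E} L _.

(* Main.v *)
From HB Require Import structures.
Require Import Defs.
From mathcomp Require Import all_boot all_order all_algebra.
From mathcomp Require Import generic_quotient.
From mathcomp Require Import complex boolp classical_sets functions reals.

(** A character f twists the action of L on E into the representation
    rho(x) = x - f(x), and the weights equal to f become the vectors that are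
    killed by some power of each rho(x). The question is then when the homology
    of L with coefficients in rho vanishes.

    The engine is a statement on a representation V of a nilpotent Lie algebra
    (trivial_subquotient_invariant): if Z is stable and L maps Z into a subspace
    B that does not contain Z, then L kills a nonzero vector of V. A
    Fitting argument replaces V by the generalized kernel of one non-nilpotent
    element after another, and never loses the classes of Z modulo B, on
    which L acts by zero; this ends with a nonzero vector on which all of
    L is locally nilpotent (trivial_subquotient_weight0). Then Engel's theorem
    applies, in the form of weight_eigenvector: a generalized weight vector
    yields a common eigenvector.

    From homology to weights. L acts on the chains E (x) /\ L by the Lie
    derivatives theta(x) = rho(x) + coad(x). Cartan's formula
    d (x /\ w) + x /\ d w = theta(x) w shows that theta(x) maps cycles to
    boundaries, and theta(x) commutes with d. If the homology in degree p is
    not zero, the engine, with Z the cycles and B the boundaries, gives a chain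
    w <> 0 with theta(x) w = 0 for all x, that is rho(x) w = - coad(x) w. As
    coad(x) is nilpotent and commutes with rho(x), some power of rho(x) kills w,
    and any nonzero coefficient of w is a weight vector.

    From weights to homology. A weight f has an eigenvector v by
    weight_eigenvector, and evaluating a bracket on v shows that f is a
    character. In the dual of E, the subspace B of the forms vanishing at v
    contains all L-translates but is not everything; so the engine gives a
    nonzero form invariant under L, i.e. vanishing on rho(L) E. Hence
    rho(L) E <> E, and H_0 = E / rho(L) E is not zero.

    The computation with d is done on functions of finite sequences of basis
    indices. A chain of degree p corresponds to an alternating function
    supported on the sequences of length p; contraction (contr) is then
    prepending an index, exterior multiplication (ext) is its adjoint, and
    everything follows from the anticommutation relations of the two. *)

Set Implicit Arguments.
Unset Strict Implicit.
Unset Printing Implicit Defensive.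

Import GRing.Theory Num.Theory.
Local Open Scope ring_scope.

(** * Locally nilpotent vectors *)
Definition loc_nilp (V : zmodType) (X : V -> V) (v : V) :=
  exists m, iter m X v = 0.

Lemma iter0_add (V : zmodType) (X : {additive V -> V}) m n v :
  iter m X v = 0 -> iter (n + m) X v = 0.
Proof.
by move=> h; rewrite iterD h; elim: n => //= n ->; rewrite raddf0.
Qed.

Lemma loc_nilpD (V : zmodType) (X : {additive V -> V}) u v :
  loc_nilp X u -> loc_nilp X v -> loc_nilp X (u + v).
Proof.
move=> [m hm] [n hn]; exists (m + n)%N.
have iterXD i a c : iter i X (a + c) = iter i X a + iter i X c.
  by elim: i => //= i ->; rewrite raddfD.
by rewrite iterXD (iter0_add m hn) addnC (iter0_add n hm) addr0.
Qed.

Section Shift.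
Variables (G : Type) (C : nat -> G -> Prop) (D : G -> G) (k : nat).
Hypothesis CS : forall i y, C i y -> C i.+1 (D y).
Variables (V W : zmodType) (X : {additive V -> V}) (X' : {additive W -> W}).
Variable phi : G -> V -> W.
Hypothesis phi0 : forall y, phi y 0 = 0.
Hypothesis phiC : forall y, C k y -> forall v, phi y v = 0.
Hypothesis phiX : forall y v, X' (phi y v) = phi y (X v) + phi (D y) v.

(** Moving X' through phi y costs either a factor X applied to v or a derivative
    D y, and both can happen only finitely often: induction on the number of
    derivatives left, then on the order of v. The lemma serves twice: with
    phi y the action of y on a module, and with phi y the exterior
    multiplication by y; in both cases D is the bracket with a fixed element. *)
Lemma loc_nilp_shift i y v :
  (i <= k)%N -> C i y -> loc_nilp X v -> loc_nilp X' (phi y v).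
Proof.
move=> ik Cy; have [j Ej] : exists j, (j + i)%N = k by exists (k - i)%N; rewrite subnK.
elim: j i y v {ik} Ej Cy => [|j IHj] i y v.
  by rewrite add0n => -> Cy _; exists 0%N; rewrite /= phiC.
rewrite addSnnS => Ej Cy [m]; elim: m v => [|m IHm] v hv.
  by exists 0%N; rewrite /= (hv : v = 0) phi0.
have [M hM] : loc_nilp X' (X' (phi y v)).
  rewrite phiX; apply: loc_nilpD; first by apply: IHm; rewrite -iterSr.
  by apply: (IHj i.+1) => //; [exact: CS | exists m.+1].
by exists M.+1; rewrite iterSr.
Qed.
End Shift.

(** * Kernels of powers and commuting families *)
Section KernelOfPowers.
Variables (F : fieldType) (V : vectType F).
Implicit Types (x : 'End(V)) (U W : {vspace V}).

Definition powv x m : 'End(V) := iter m (comp_lfun x) \1%VF.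

Lemma powvE x m v : powv x m v = iter m x v.
Proof. by elim: m => [|m IH]; rewrite /= ?id_lfunE // comp_lfunE IH. Qed.

(** The kernels of the powers of x increase, so the one of maximal dimension
    contains all of them. *)
Lemma kernel_stabilizes x :
  exists M, forall m v, iter m x v = 0 -> iter M x v = 0.
Proof.
pose P d := `[< exists m, \dim (lker (powv x m)) = d >].
have exP : exists d, P d by exists (\dim (lker (powv x 0))); apply/asboolP; exists 0%N.
have ubP d : P d -> (d <= \dim {:V})%N.
  by move=> /asboolP [m <-]; apply/dimvS/subvf.
case: (ex_maxnP exP ubP) => d /asboolP [M hM] max.
exists M => m v hv.
have sub : (lker (powv x M) <= lker (powv x (m + M)))%VS.
  by apply/subvP => u; rewrite !memv_ker !powvE => /eqP /(iter0_add m) ->.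
have eqk : lker (powv x M) = lker (powv x (m + M)).
  apply/eqP; rewrite eqEdim sub /= hM; apply: max.
  by apply/asboolP; exists (m + M)%N.
apply/eqP; rewrite -powvE -memv_ker eqk memv_ker powvE addnC.
by rewrite (iter0_add M hv).
Qed.

Lemma iter_stable x U : {in U, forall v, x v \in U} ->
  forall m, {in U, forall v, iter m x v \in U}.
Proof. by move=> xU m v vU; elim: m => //= m /xU. Qed.

(** As x^M and x^(2M) have the same kernel, they have images of the same
    dimension on U, and these are nested; so x^M v = x^(2M) u for some u in U,
    and v is the sum of v - x^M u, killed by x^M, and of x^M u. *)
Lemma fitting x U M : {in U, forall v, x v \in U} ->
    (forall m v, iter m x v = 0 -> iter M x v = 0) ->
  {in U, forall v, exists2 u, u \in U & iter M x (v - iter M x u) = 0}.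
Proof.
move=> xU stabM v vU.
have ker2 : lker (powv x (M + M)) = lker (powv x M).
  apply/vspaceP => u; rewrite !memv_ker !powvE; apply/eqP/eqP; first exact: stabM.
  exact: iter0_add.
have img2 : (powv x (M + M) @: U)%VS = (powv x M @: U)%VS.
  apply/eqP; rewrite eqEdim; apply/andP; split.
    apply/subvP => _ /memv_imgP [u uU ->]; rewrite powvE iterD -powvE.
    by rewrite memv_img // iter_stable.
  have := limg_ker_dim (powv x (M + M)) U; rewrite ker2 -(limg_ker_dim (powv x M) U).
  by move/addnI => ->.
have : powv x M v \in (powv x (M + M) @: U)%VS by rewrite img2 memv_img.
case/memv_imgP => u uU; rewrite !powvE => E; exists u => //.
by rewrite -powvE linearB /= !powvE -iterD E subrr.
Qed.

Lemma dimv_lt U W v : (U <= W)%VS -> v \in W -> v \notin U -> (\dim U < \dim W)%N.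
Proof.
move=> sUW vW vU; rewrite ltnNge; apply: contra vU => le.
by rewrite (_ : U = W) //; apply/eqP; rewrite eqEdim sUW.
Qed.

(** Turns a subspace given by infinitely many conditions, such as a weight
    space, into a vspace: one of maximal dimension among those inside P cannot
    miss a vector of P, since it could be enlarged by the line of this vector. *)
Lemma subspace_of_pred (P : V -> Prop) :
    P 0 -> (forall a u v, P u -> P v -> P (a *: u + v)) ->
  exists W : {vspace V}, forall v, v \in W <-> P v.
Proof.
move=> P0 PD.
pose Q d := `[< exists W : {vspace V}, \dim W = d /\ forall v, v \in W -> P v >].
have exQ : exists d, Q d.
  exists 0%N; apply/asboolP; exists 0%VS; split; first exact: dimv0.
  by move=> v; rewrite memv0 => /eqP ->.
have ubQ d : Q d -> (d <= \dim {:V})%N.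
  by move=> /asboolP [W [<- _]]; apply/dimvS/subvf.
case: (ex_maxnP exQ ubQ) => d /asboolP [W [dW WP]] max; exists W => v.
split; first exact: WP.
move=> Pv; apply: contrapT => /negP vW.
have : (\dim (W + <[v]>) <= d)%N.
  apply: max; apply/asboolP; exists (W + <[v]>)%VS; split => // u.
  move=> /memv_addP [w wW [_ /vlineP [a ->] ->]].
  by rewrite addrC; apply: PD => //; exact: WP.
rewrite leqNgt -dW => /negP; apply; apply: dimv_lt (addvSl _ _) _ vW.
by rewrite -{1}[v]add0r memv_add ?mem0v ?memv_line.
Qed.

Lemma nonzero_vector U : U != 0%VS -> exists2 v, v \in U & v != 0.
Proof. by move=> U0; exists (vpick U); rewrite ?memv_pick ?vpick0. Qed.

(** As long as some s in S is not zero on W, its kernel in W is a smaller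
    nonzero subspace, and it inherits the hypotheses since all of T commutes
    with s. The family T is there to keep track of the stability under
    operators that need not be nilpotent. *)
Lemma commuting_nilpotents_kernel (S T : 'End(V) -> Prop) W :
    (forall s, S s -> T s) -> W != 0%VS ->
    (forall t, T t -> {in W, forall v, t v \in W}) ->
    (forall s t, S s -> T t -> {in W, forall v, s (t v) = t (s v)}) ->
    (forall s, S s -> {in W, forall v, loc_nilp s v}) ->
  exists W', [/\ (W' <= W)%VS, W' != 0%VS,
    forall t, T t -> {in W', forall v, t v \in W'}
    & forall s, S s -> {in W', forall v, s v = 0}].
Proof.
move=> ST; have [d] := ubnP (\dim W); elim: d W => // d IH W dW W0 TW comm nil.
have [allS|/existsNP [s /not_implyP [Ss]]] :=
  pselect (forall s, S s -> {in W, forall v, s v = 0}).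
  by exists W; split.
move=> nz; have {nz} [v vW sv0] : exists2 v, v \in W & s v != 0.
  apply: contrapT => h; apply: nz => v vW; apply/eqP; apply: contrapT => sv0.
  by apply: h; exists v => //; apply/negP.
have kerE u : u \in (W :&: lker s)%VS = (u \in W) && (s u == 0).
  by rewrite memv_cap memv_ker.
have /IH : (\dim (W :&: lker s) < d)%N.
  rewrite -ltnS; apply: leq_trans dW; rewrite ltnS.
  apply: dimv_lt (capvSl _ _) vW _.
  by rewrite kerE negb_and sv0 orbT.
case.
- have [m hm] := nil s Ss v vW; apply: contraNneq sv0 => ker0.
  suff : iter 1 s v = 0 by move=> /= ->.
  elim: m hm => [/= -> | m IHm hm]; first by rewrite linear0.
  apply: IHm; apply/eqP; rewrite -memv0 -ker0 kerE -iterS hm eqxx andbT.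
  by apply: iter_stable => //; exact/TW/ST.
- move=> t Tt u; rewrite !kerE => /andP [uW /eqP su0].
  by rewrite TW //= comm // su0 linear0 /=.
- by move=> s' t Ss' Tt u; rewrite kerE => /andP [uW _]; exact: comm.
- by move=> s' Ss' u; rewrite kerE => /andP [uW _]; exact: nil.
move=> W' [sub nz TW' SW']; exists W'; split=> //.
exact: subv_trans sub (capvSl _ _).
Qed.
End KernelOfPowers.

(** The commutator of x with z^(m+1) is (m+1) c z^m. If c <> 0, then in
    characteristic 0 the vanishing of z^(m+1) on W entails that of z^m, and
    so on down to z^0, which is the identity. This replaces the comparison of
    traces in the usual proof that weights vanish on brackets. *)
Lemma scalar_commutator_nilpotent (F : numFieldType) (V : vectType F)
    (x z : 'End(V)) (W : {vspace V}) (c : F) :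
    W != 0%VS -> {in W, forall v, x v \in W} -> {in W, forall v, z v \in W} ->
    {in W, forall v, loc_nilp z v} ->
    {in W, forall v, x (z v) - z (x v) = c *: v} ->
  c = 0.
Proof.
move=> W0 xW zW nil comm; apply: contraNeq W0 => c0.
have [M stabM] := kernel_stabilizes z.
have commM m : {in W, forall v,
    x (iter m.+1 z v) - iter m.+1 z (x v) = (m.+1%:R * c) *: iter m z v}.
  elim: m => [|m IH] v vW; first by rewrite mul1r comm.
  have zmW : iter m.+1 z v \in W by exact: iter_stable.
  rewrite [in RHS]mulrSr mulrDl mul1r scalerDl.
  have -> : (m.+1%:R * c) *: iter m.+1 z v = z ((m.+1%:R * c) *: iter m z v).
    by rewrite linearZ.
  rewrite -(IH v vW) linearB /=.
  have /= <- := comm _ zmW.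
  by rewrite [RHS]addrC addrA subrK.
have : {in W, forall v, iter M z v = 0}.
  by move=> v /nil [m hm]; exact: stabM hm.
elim: M {stabM} => [|M IH] hM.
  by rewrite -subv0; apply/subvP => v /hM /= ->; rewrite mem0v.
apply: IH => v vW; have := commM M v vW; rewrite hM // hM ?xW // linear0 subrr.
move/esym/eqP; rewrite scaler_eq0 mulf_eq0 pnatr_eq0 (negPf c0) /=.
by move/eqP.
Qed.

Definition shiftv (F : fieldType) (V : vectType F) (x : 'End(V)) (a : F) :
  'End(V) := x - a *: \1%VF.

Lemma shiftvE (F : fieldType) (V : vectType F) (x : 'End(V)) a v :
  shiftv x a v = x v - a *: v.
Proof. by rewrite add_lfunE opp_lfunE scale_lfunE id_lfunE. Qed.

Lemma shiftv0 (F : fieldType) (V : vectType F) (x : 'End(V)) : shiftv x 0 = x.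
Proof. by rewrite /shiftv scale0r subr0. Qed.

Lemma lfunBZ (F : fieldType) (V W : vectType F) (f : 'Hom(V, W)) c u v :
  f (u - c *: v) = f u - c *: f v.
Proof. by rewrite linearB linearZ. Qed.

Lemma shiftv_comm (F : fieldType) (V : vectType F) (x y : 'End(V)) a b v :
  shiftv x a (shiftv y b v) - shiftv y b (shiftv x a v) = x (y v) - y (x v).
Proof.
have zmodE (p q r A B : V) : A - p - (q - r) - (B - q - (p - r)) = A - B.
  by rewrite !opprB addrACA !subrKA.
by rewrite !shiftvE !lfunBZ !scalerBr !scalerA [b * a]mulrC zmodE.
Qed.

(** * Representations of nilpotent Lie algebras *)

(* The Lie algebra appears only through its bracket and a descending central
   series C 0, ..., C k whose last term acts by zero. The bracket acts as
   the commutator of the opposite algebra. *)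
Section NilpotentRepresentation.
Variables (F : numFieldType) (V : vectType F).
Variables (G : Type) (br : G -> G -> G) (C : nat -> G -> Prop) (k : nat).
Hypothesis C0 : forall z, C 0 z.
Hypothesis CS : forall i z x, C i z -> C i.+1 (br z x).
Variable rho : G -> 'End(V).
Hypothesis rho_br : forall x y v,
  rho (br x y) v = rho y (rho x v) - rho x (rho y v).
Hypothesis rhoC : forall z, C k z -> rho z = 0.

Definition stable (W : {vspace V}) := forall x, {in W, forall v, rho x v \in W}.

(** The generalized eigenspaces of rho x are stable under all of L, since the
    bracket with x is nilpotent. The scalar a is arbitrary, so that this
    applies before the weight is known to be a character. *)
Lemma stable_loc_nilp (a : F) x y v :
  loc_nilp (shiftv (rho x) a) v -> loc_nilp (shiftv (rho x) a) (rho y v).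
Proof.
apply: (@loc_nilp_shift _ C (fun y => br y x) k _ V V _ _
         (fun y v => rho y v) _ _ _ 0 y v) => //.
- by move=> i z; exact: CS.
- by move=> z; rewrite linear0.
- by move=> z /rhoC -> u; rewrite zero_lfunE.
- move=> z u /=; rewrite !shiftvE rho_br lfunBZ.
  by rewrite [RHS]addrC subrKA.
Qed.

Section Eigenvector.
Variable alpha : G -> F.
Hypothesis alphaC : forall z, C k z -> alpha z = 0.

(** Going up from C k to C 0 along the central series, one keeps a nonzero stable
    subspace of the weight space on which C i acts by the scalars alpha. For
    z in C i, the bracket of z and x is in C i.+1 and so acts by a scalar,
    which vanishes by scalar_commutator_nilpotent. Hence C i commutes with L
    there, and commuting_nilpotents_kernel gives the next subspace. *)
Lemma weight_eigenvector v0 : v0 != 0 ->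
    (forall x, loc_nilp (shiftv (rho x) (alpha x)) v0) ->
  exists2 v, v != 0 & forall x, rho x v = alpha x *: v.
Proof.
move=> v00 wt; pose X x := shiftv (rho x) (alpha x).
have XE x v : X x v = rho x v - alpha x *: v by rewrite shiftvE.
have [W Wwt] : exists W : {vspace V},
    forall v, v \in W <-> forall x, loc_nilp (X x) v.
  apply: subspace_of_pred => [x|a u v Pu Pv x]; first by exists 0%N.
  apply: loc_nilpD; last exact: Pv.
  have [m hm] := Pu x; exists m.
  by rewrite -powvE linearZ /= powvE hm scaler0.
have step j i : (j + i = k)%N -> exists W' : {vspace V},
    [/\ (W' <= W)%VS, W' != 0%VS, stable W'
      & forall z, C i z -> {in W', forall v, X z v = 0}].
  elim: j i => [i|j IH i]; first rewrite add0n => ->.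
    exists W; split=> //.
    - by apply: contraNneq v00 => W0; rewrite -memv0 -W0; apply/Wwt.
    - by move=> y v /Wwt vW; apply/Wwt => x; apply: stable_loc_nilp; exact: vW.
    - by move=> z Cz v _; rewrite XE rhoC // alphaC // zero_lfunE scale0r subrr.
  rewrite addSnnS => /IH [U [sUW U0 Ust Ueig]].
  have UX x : {in U, forall v, X x v \in U}.
    by move=> v vU; rewrite XE memvB ?memvZ ?Ust.
  have Unil x : {in U, forall v, loc_nilp (X x) v}.
    by move=> v vU; move: x; apply/Wwt/(subvP sUW).
  have comm z x v : X x (X z v) - X z (X x v) = rho (br z x) v.
    by rewrite rho_br; exact: shiftv_comm.
  have commU z x : C i z -> {in U, forall v, rho (br z x) v = 0}.
    move=> Cz; have eig v : v \in U -> rho (br z x) v = alpha (br z x) *: v.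
      by move=> vU; apply/eqP; rewrite -subr_eq0 -XE (Ueig _ (CS x Cz)).
    have c0 : alpha (br z x) = 0.
      apply: (@scalar_commutator_nilpotent _ _ (X x) (X z) U) => // v vU.
      by rewrite comm eig.
    by move=> v vU; rewrite eig // c0 scale0r.
  case: (@commuting_nilpotents_kernel _ _ (fun s => exists2 z, C i z & s = X z)
           (fun t => exists x, t = X x) U) => //.
  - by move=> s [z _ ->]; exists z.
  - by move=> t [x ->].
  - move=> s t [z Cz ->] [x ->] v vU; apply/esym/eqP; rewrite -subr_eq0 comm.
    by rewrite (commU z x Cz).
  - by move=> s [z _ ->].
  move=> U' [sU' U'0 U'st U'eig]; exists U'; split => //.
  - exact: subv_trans sU' sUW.
  - move=> x v vU; have := U'st (X x) (ex_intro _ x erefl) v vU.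
    by rewrite XE => h; rewrite -(subrK (alpha x *: v) (rho x v)) memvD ?memvZ.
  - by move=> z Cz v vU; apply: (U'eig (X z)) => //; exists z.
have [W' [_ W'0 _ W'e]] := step k 0%N (addn0 k).
have [v vW v0n] := nonzero_vector W'0; exists v => // x.
by apply/eqP; rewrite -subr_eq0 -XE (W'e x).
Qed.
End Eigenvector.

(** Induction on the dimension of a stable W that meets Z outside B. If some x
    is not locally nilpotent on W, the generalized kernel of x in W is a smaller
    stable subspace. By Fitting, z in Z :&: W differs from an element of this
    kernel by an element of x Z, which lies in B; so the kernel still meets Z
    outside B. *)
Lemma trivial_subquotient_weight0 (Z B : {vspace V}) z0 :
    stable Z -> (forall x, {in Z, forall v, rho x v \in B}) ->
    z0 \in Z -> z0 \notin B ->
  exists2 v, v != 0 & forall x, loc_nilp (rho x) v.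
Proof.
move=> Zst ZB z0Z z0B.
suff H d : forall W, (\dim W < d)%N -> stable W ->
    (exists z, [/\ z \in Z, z \in W & z \notin B]) ->
    exists2 v, v != 0 & forall x, loc_nilp (rho x) v.
  apply: (H _ fullv (ltnSn _)); first by move=> x v _; exact: memvf.
  by exists z0; rewrite memvf.
elim: d => // d IH W dW Wst [z [zZ zW zB]].
have [all|/existsNP [x /existsNP [w /not_implyP [w_in_W wnil]]]] :=
  pselect (forall x v, v \in W -> loc_nilp (rho x) v).
  exists z; first by apply: contraNneq zB => ->; rewrite mem0v.
  by move=> x; exact: all.
have [M stabM] := kernel_stabilizes (rho x).
pose W' := (W :&: lker (powv (rho x) M.+1))%VS.
have W'E v : v \in W' = (v \in W) && (iter M.+1 (rho x) v == 0).
  by rewrite memv_cap memv_ker powvE.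
have stabS m v : iter m (rho x) v = 0 -> iter M.+1 (rho x) v = 0.
  by move/stabM => h; rewrite -add1n (iter0_add 1 h).
apply: (IH W').
- rewrite -ltnS; apply: leq_trans dW; rewrite ltnS.
  apply: (dimv_lt (capvSl _ _) w_in_W); rewrite W'E w_in_W /=.
  by apply: contra_notN wnil => /eqP h; exists M.+1.
- move=> y v; rewrite !W'E => /andP [vW /eqP hv]; rewrite Wst //=; apply/eqP.
  have := @stable_loc_nilp 0 x y v; rewrite shiftv0.
  by case=> [|m]; [exists M.+1 | exact: stabS].
- (* The correction x^(M+1) u lies in B because the exponent is positive. *)
  have ZW v : v \in (Z :&: W)%VS -> rho x v \in (Z :&: W)%VS.
    by rewrite !memv_cap => /andP [vZ vW]; rewrite Zst ?Wst.
  have zZW : z \in (Z :&: W)%VS by rewrite memv_cap zZ.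
  have [u uZW hu] := fitting ZW stabS zZW.
  have := iter_stable ZW M.+1 uZW; rewrite memv_cap => /andP [iZ iW].
  exists (z - iter M.+1 (rho x) u); split; first by rewrite memvB.
    by rewrite W'E hu eqxx memvB.
  apply: contra zB => h; rewrite -(subrK (iter M.+1 (rho x) u) z) memvD //.
  by rewrite iterS ZB //; have := iter_stable ZW M uZW; rewrite memv_cap => /andP [].
Qed.

Lemma trivial_subquotient_invariant (Z B : {vspace V}) z0 :
    stable Z -> (forall x, {in Z, forall v, rho x v \in B}) ->
    z0 \in Z -> z0 \notin B ->
  exists2 v, v != 0 & forall x, rho x v = 0.
Proof.
move=> Zst ZB z0Z z0B.
have [v v0 nil] := trivial_subquotient_weight0 Zst ZB z0Z z0B.
have [||w w0 hw] := @weight_eigenvector (fun=> 0) _ v v0; first by [].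
  by move=> x; rewrite shiftv0.
by exists w => // x; rewrite hw scale0r.
Qed.
End NilpotentRepresentation.

(** * The bracket of L *)
Section LieBracket.
Variables (F : fieldType) (E : vectType F) (L : lieSubalgebra E).
Local Notation gL := (subvs_of L).
Implicit Types x y z : gL.

Lemma lie_bracketE x y e :
  vsval (lie_bracket x y) e = vsval y (vsval x e) - vsval x (vsval y e).
Proof. by rewrite /= add_lfunE opp_lfunE !comp_lfunE. Qed.

Lemma subvs_lfunP x y : (forall e, vsval x e = vsval y e) -> x = y.
Proof. by move=> h; apply/val_inj/lfunP. Qed.

Lemma vsvalPE a x y e : vsval (a *: x + y) e = a *: vsval x e + vsval y e.
Proof. by rewrite linearP add_lfunE scale_lfunE. Qed.

Lemma vsvalBE x y e : vsval (x - y) e = vsval x e - vsval y e.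
Proof. by rewrite linearB add_lfunE opp_lfunE. Qed.

Lemma lie_bracketC x y : lie_bracket x y = - lie_bracket y x.
Proof.
by apply: subvs_lfunP => e; rewrite linearN opp_lfunE !lie_bracketE opprB.
Qed.

(** Bracketing on the right, as L acts on E from the right. *)
Definition ad y x := lie_bracket x y.

Lemma ad_linear y : linear (ad y).
Proof.
move=> a u v; apply: subvs_lfunP => e.
rewrite /ad vsvalPE !lie_bracketE !vsvalPE linearP /=.
by rewrite scalerBr opprD addrACA.
Qed.
HB.instance Definition _ y := GRing.isLinear.Build F gL gL *:%R
  (ad y) (ad_linear y).

Lemma jacobi x y z :
  ad y (ad x z) - ad x (ad y z) = ad (lie_bracket x y) z.
Proof.
apply: subvs_lfunP => e; rewrite /ad vsvalBE !lie_bracketE.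
have lfunB (g : 'End(E)) u v : g (u - v) = g u - g v by rewrite linearB.
rewrite !lfunB !opprB [LHS]addrACA !subrKA.
by rewrite [RHS]addrACA [- _ - _]addrC -[RHS]addrACA.
Qed.

Lemma basis_expansion (M : lmodType F) (g : {linear gL -> M}) y :
  \sum_j coord (vbasis {:gL}) j y *: g (vbasis {:gL})`_j = g y.
Proof.
rewrite [in RHS](coord_vbasis (memvf y)) linear_sum.
by apply: eq_bigr => j _; rewrite linearZ.
Qed.
End LieBracket.

(** * Contraction and exterior multiplication *)
Section Forms.
Variables (F : numFieldType) (E : vectType F) (L : lieSubalgebra E).
Local Notation gL := (subvs_of L).
Local Notation n := (\dim {:gL}).
Local Notation b := (vbasis {:gL}).
Local Notation form := (seq 'I_n -> E).
Implicit Types (x y : gL) (w : form) (t : seq 'I_n).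

(** A form gives the coefficients of a chain in the basis b for all index
    sequences, not only the increasing ones; contr i is the interior product
    with the i-th vector of the dual basis. *)
Definition contr (i : 'I_n) w : form := fun t => w (i :: t).

Lemma contr_linear i : linear (contr i). Proof. by []. Qed.
HB.instance Definition _ i := GRing.isLinear.Build F form form *:%R
  (contr i) (contr_linear i).

(** Left exterior multiplication by y: the expansion of y /\ w along the
    successive indices, organised so that the anticommutation relation
    contr_ext holds by definition. *)
Fixpoint ext (y : gL) (w : form) (t : seq 'I_n) : E :=
  if t is i :: t' then coord b i y *: w t' - ext y (contr i w) t' else 0.

Lemma contr_ext i y w :
  contr i (ext y w) = coord b i y *: w - ext y (contr i w).
Proof. by []. Qed.

Lemma ext_linear y : linear (ext y).
Proof.
move=> a u v; apply/funext => t; elim: t u v => [|i t IH] u v.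
  by rewrite !fctE /= scaler0 addr0.
rewrite -[LHS]/(_ *: (a *: u t + v t) - ext y (a *: contr i u + contr i v) t) IH.
rewrite -[RHS]/(a *: (_ *: u t - ext y (contr i u) t)
  + (_ *: v t - ext y (contr i v) t)).
by rewrite -[in LHS]/(a *: ext y _ t + ext y _ t)
  scalerBr scalerDr !scalerA [_ * a]mulrC opprD addrACA.
Qed.
HB.instance Definition _ y := GRing.isLinear.Build F form form *:%R
  (ext y) (ext_linear y).

(** The same operation as a function of the vector, to make it a linear map of
    y; likewise act_of below. *)
Definition ext_of w y := ext y w.

Lemma ext_of_linear w : linear (ext_of w).
Proof.
move=> a x y; apply/funext => t; elim: t w => [|i t IH] w.
  by rewrite !fctE /= scaler0 addr0.
rewrite -[LHS]/(_ *: w t - ext_of (contr i w) (a *: x + y) t) IH.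
rewrite -[RHS]/(a *: (_ *: w t - ext x (contr i w) t)
  + (_ *: w t - ext y (contr i w) t)).
by rewrite -[in LHS]/(a *: ext x _ t + ext y _ t) linearP /=
  scalerDl scalerBr scalerA opprD addrACA.
Qed.
HB.instance Definition _ w := GRing.isLinear.Build F gL form *:%R
  (ext_of w) (ext_of_linear w).

Lemma ext_ext x y w : ext x (ext y w) = - ext y (ext x w).
Proof.
apply/funext => t; elim: t w => [|i t IH] w; first by rewrite fctE /= oppr0.
have ecE u z : ext u (ext z w) (i :: t) = coord b i u *: ext z w t
    - (coord b i z *: ext u w t - ext u (ext z (contr i w)) t).
  rewrite -[LHS]/(contr i (ext u (ext z w)) t) !contr_ext linearB linearZ.
  by [].
rewrite -[RHS]/(- (ext y (ext x w) (i :: t))) !ecE IH.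
by rewrite -[(- _) t]/(- (ext y (ext x _) t)) opprK [RHS]opprB
  -[RHS]addrA -opprD; congr (_ - _); exact: addrC.
Qed.

(** It is enough to exchange neighbours; the prefix u makes the notion stable
    under contraction. *)
Definition alternating w :=
  forall u i j t, w (u ++ i :: j :: t) = - w (u ++ j :: i :: t).

Lemma contr_contr i j w : alternating w ->
  contr i (contr j w) = - contr j (contr i w).
Proof. by move=> aw; apply/funext => t; exact: (aw [::]). Qed.

Lemma contr_alt i w : alternating w -> alternating (contr i w).
Proof. by move=> aw u; exact: (aw (i :: u)). Qed.

Lemma ext_alt y w : alternating w -> alternating (ext y w).
Proof.
move=> aw u; elim: u w aw => [|k u IH] w aw i j t /=.
  rewrite (contr_contr j i aw) linearN.
  rewrite -[(- _) t]/(- (ext y _ t)) opprK [RHS]opprB -[RHS]addrA -opprD.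
  congr (_ - _); exact: addrC.
by rewrite (IH _ (contr_alt k aw)) aw scalerN opprD.
Qed.

Lemma add_alt u v : alternating u -> alternating v -> alternating (u + v).
Proof. by move=> au av s i j t; rewrite !fctE au av opprD. Qed.

Lemma scale_alt a w : alternating w -> alternating (a *: w).
Proof. by move=> aw s i j t; rewrite !fctE aw scalerN. Qed.

Lemma sum_alt I (r : seq I) (w : I -> form) :
  (forall i, alternating (w i)) -> alternating (\sum_(i <- r) w i).
Proof.
move=> aw; apply: (big_ind alternating) => [s i j t||i _].
- by apply/esym; exact: oppr0.
- exact: add_alt.
- exact: aw.
Qed.

Definition homog p w := forall t, size t != p -> w t = 0.

Lemma contr_homog p i w : homog p.+1 w -> homog p (contr i w).
Proof. by move=> hw t tp; apply: hw. Qed.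

Lemma contr_homog0 i w : homog 0 w -> contr i w = 0.
Proof. by move=> hw; apply/funext => t; exact: hw. Qed.

Lemma ext_homog p y w : homog p w -> homog p.+1 (ext y w).
Proof.
move=> hw t; elim: t p w hw => [//|i t IH] p w hw; rewrite eqSS => tp /=.
rewrite hw // scaler0 sub0r.
case: p hw tp => [hw _|p hw tp]; first by rewrite contr_homog0 // linear0 oppr0.
by rewrite (IH _ _ (contr_homog i hw)) // oppr0.
Qed.

Lemma add_homog p u v : homog p u -> homog p v -> homog p (u + v).
Proof. by move=> hu hv t tp; rewrite !fctE hu // hv // addr0. Qed.

Lemma scale_homog p a w : homog p w -> homog p (a *: w).
Proof. by move=> hw t tp; rewrite fctE hw // scaler0. Qed.

Lemma sum_homog p I (r : seq I) (w : I -> form) :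
  (forall i, homog p (w i)) -> homog p (\sum_(i <- r) w i).
Proof.
move=> hw; apply: (big_ind (homog p)) => [t _||i _] //.
exact: add_homog.
Qed.

Lemma coord_vbasis_delta (i j : 'I_n) : coord b i b`_j = (j == i)%:R.
Proof. by rewrite coord_free // (basis_free (vbasisP _)). Qed.

(** The Euler identity: on alternating forms, contracting with the dual basis
    and multiplying back by the basis counts the degree. By the
    anticommutation relations, each index peeled off contributes one. *)
Lemma number_operator p w : alternating w -> homog p w ->
  \sum_(j < n) ext b`_j (contr j w) = p%:R *: w.
Proof.
move=> aw hw; apply/funext => t.
suff -> : (\sum_(j < n) ext b`_j (contr j w)) t = (size t)%:R *: w t.
  rewrite -[RHS]/(p%:R *: w t).
  by have [->//|/hw ->] := eqVneq (size t) p; rewrite !scaler0.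
elim: t w aw {hw} => [|i t IH] w aw.
  by rewrite fct_sumE scale0r big1.
rewrite -[LHS]/(contr i (\sum_(j < n) ext b`_j (contr j w)) t) linear_sum /=.
under eq_bigr => j _ do rewrite contr_ext (contr_contr _ _ aw) linearN opprK.
rewrite big_split /= (bigD1 i) //= coord_vbasis_delta eqxx scale1r big1 ?addr0.
  rewrite -[LHS]/(w (i :: t) + (\sum_(j < n) ext b`_j (contr j (contr i w))) t).
  by rewrite IH; [rewrite mulrSr scalerDl scale1r addrC | exact: contr_alt].
by move=> j ji; rewrite coord_vbasis_delta (negPf ji) scale0r.
Qed.

(** By number_operator, in characteristic 0 an alternating form of positive
    degree is a combination of products of vectors by forms of lower degree.
    An identity that passes through ext thus only has to be
    checked in degree 0. *)
Lemma form_ind (P : form -> Prop) :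
    (forall w, homog 0 w -> P w) ->
    (forall a u v, P u -> P v -> P (a *: u + v)) ->
    (forall y w, alternating w -> P w -> P (ext y w)) ->
  forall p w, alternating w -> homog p w -> P w.
Proof.
move=> P0 PD Pext; elim=> [|p IH] w aw hw; first exact: P0.
have Pz : P 0 by apply: P0.
have -> : w = p.+1%:R^-1 *: (\sum_(j < n) ext b`_j (contr j w)) + 0.
  by rewrite (number_operator aw hw) scalerA mulVf ?scale1r ?addr0 // pnatr_eq0.
apply: (PD) => //; apply: (big_ind P) => // [u v Pu Pv|j _].
  by rewrite -[u]scale1r; exact: PD.
by apply: Pext; [exact: contr_alt | apply: IH; [exact: contr_alt | exact: contr_homog]].
Qed.

(** * The differential and Cartan's formula *)
Variable f : dual_lie L.
Hypothesis hf : lie_character f.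

Definition shift_act x : 'End(E) := shiftv (vsval x) (f x).

Lemma shift_actE x e : shift_act x e = vsval x e - f x *: e.
Proof. exact: shiftvE. Qed.

Definition act x w : form := fun t => shift_act x (w t).

Lemma act_linear x : linear (act x).
Proof. by move=> a u v; apply/funext => t; rewrite /act linearP. Qed.
HB.instance Definition _ x := GRing.isLinear.Build F form form *:%R
  (act x) (act_linear x).

Definition act_of w x := act x w.

Lemma act_of_linear w : linear (act_of w).
Proof.
move=> a x y; apply/funext => t.
rewrite -[RHS]/(a *: shift_act x (w t) + shift_act y (w t)).
rewrite /act_of /act !shift_actE vsvalPE linearP /= scalerDl scalerBr scalerA.
by rewrite opprD addrACA.
Qed.
HB.instance Definition _ w := GRing.isLinear.Build F gL form *:%R
  (act_of w) (act_of_linear w).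

Lemma act_bracket x y w :
  act (lie_bracket x y) w = act y (act x w) - act x (act y w).
Proof.
apply/funext => t.
rewrite -[RHS]/(shift_act y (shift_act x (w t)) - shift_act x (shift_act y (w t))).
by rewrite shiftv_comm /act shift_actE lie_bracketE hf scale0r subr0.
Qed.

Lemma act_contr x i w : act x (contr i w) = contr i (act x w).
Proof. by []. Qed.

Lemma act_ext x y w : act x (ext y w) = ext y (act x w).
Proof.
apply/funext => t; rewrite /act; elim: t w => [|i t IH] w /=; first by rewrite linear0.
by rewrite linearB linearZ /= IH.
Qed.

Lemma act_alt x w : alternating w -> alternating (act x w).
Proof. by move=> aw u i j t; rewrite /act aw linearN. Qed.

Lemma act_homog p x w : homog p w -> homog p (act x w).
Proof. by move=> hw t tp; rewrite /act hw // linear0. Qed.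

(** The action of x on /\ L extending ad x as a derivation, with E left alone. *)
Definition coad x w : form := \sum_(j < n) ext (ad x b`_j) (contr j w).

Lemma coad_linear x : linear (coad x).
Proof.
move=> a u v; rewrite /coad scaler_sumr -big_split; apply: eq_bigr => j _.
by rewrite !linearP.
Qed.
HB.instance Definition _ x := GRing.isLinear.Build F form form *:%R
  (coad x) (coad_linear x).

Lemma coad_alt x w : alternating w -> alternating (coad x w).
Proof. by move=> aw; apply: sum_alt => j; apply/ext_alt/contr_alt. Qed.

Lemma coad_homog p x w : homog p w -> homog p (coad x w).
Proof.
case: p => [|p] hw; last by apply: sum_homog => j; apply/ext_homog/contr_homog.
by rewrite /coad big1 // => j _; rewrite contr_homog0 // linear0.
Qed.

Lemma coad_homog0 x w : homog 0 w -> coad x w = 0.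
Proof. by move=> hw; rewrite /coad big1 // => j _; rewrite contr_homog0 // linear0. Qed.

Lemma act_coad x y w : act x (coad y w) = coad y (act x w).
Proof.
by rewrite /coad linear_sum; apply: eq_bigr => j _; rewrite /= act_ext act_contr.
Qed.

Lemma coad_ext x y w : coad x (ext y w) = ext (ad x y) w + ext y (coad x w).
Proof.
have -> : ext (ad x y) w = \sum_j coord b j y *: ext (ad x b`_j) w.
  exact/esym/(basis_expansion (ext_of w \o ad x)).
rewrite /coad linear_sum -big_split.
apply: eq_bigr => j _ /=.
by rewrite contr_ext linearB linearZ /= ext_ext opprK.
Qed.

Lemma coad_contr x i w : alternating w ->
  contr i (coad x w) = (\sum_(j < n) coord b i (ad x b`_j) *: contr j w)
    + coad x (contr i w).
Proof.
move=> aw; rewrite /coad linear_sum -big_split; apply: eq_bigr => j _ /=.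
by rewrite contr_ext (contr_contr _ _ aw) linearN opprK.
Qed.

(** The double sums that arise from moving coad u past a contraction are
    the actions with the two brackets in the opposite order; they leave
    the difference of double brackets to which the Jacobi identity applies. *)
Lemma coad_bracket x y w : alternating w ->
  coad (lie_bracket x y) w = coad y (coad x w) - coad x (coad y w).
Proof.
move=> aw.
pose S u v := \sum_(j < n) ext (ad u (ad v b`_j)) (contr j w).
have coadS u v : coad u (coad v w) = S u v + (coad v (coad u w) - S v u).
  rewrite {2}/coad linear_sum /=.
  under eq_bigr => j _ do rewrite coad_ext.
  rewrite big_split; congr (_ + _); apply/eqP; rewrite eq_sym subr_eq.
  apply/eqP; rewrite {1}/coad.
  have -> : S v u = \sum_(j < n) ext (ad v b`_j)
      (\sum_(k < n) coord b j (ad u b`_k) *: contr k w).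
    under eq_bigr => j _ do rewrite linear_sum.
    rewrite exchange_big; apply: eq_bigr => k _ /=.
    under eq_bigr => j _ do rewrite linearZ.
    exact/esym/(basis_expansion (ext_of (contr k w) \o ad v)).
  rewrite -big_split; apply: eq_bigr => j _ /=.
  by rewrite -linearD (coad_contr _ _ aw) addrC.
rewrite [coad y _]coadS [S y x + _]addrCA [RHS]addrC addKr /S.
rewrite -sumrB; apply: eq_bigr => j _.
by rewrite -jacobi -[LHS]/(ext_of _ _) linearB.
Qed.

(** The Lie derivative on chains with coefficients in the twisted module. *)
Definition theta x w : form := act x w + coad x w.

Lemma theta_linear x : linear (theta x).
Proof. by move=> a u v; rewrite /theta !linearP scalerDr addrACA. Qed.
HB.instance Definition _ x := GRing.isLinear.Build F form form *:%R
  (theta x) (theta_linear x).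

Lemma theta_alt x w : alternating w -> alternating (theta x w).
Proof. by move=> aw; apply: add_alt; [exact: act_alt | exact: coad_alt]. Qed.

Lemma theta_homog p x w : homog p w -> homog p (theta x w).
Proof. by move=> aw; apply: add_homog; [exact: act_homog | exact: coad_homog]. Qed.

Lemma theta_ext x y w : theta x (ext y w) = ext (ad x y) w + ext y (theta x w).
Proof. by rewrite /theta act_ext coad_ext linearD addrCA. Qed.

Lemma theta_bracket x y w : alternating w ->
  theta (lie_bracket x y) w = theta y (theta x w) - theta x (theta y w).
Proof.
move=> aw; rewrite /theta act_bracket (coad_bracket _ _ aw) !linearD /=.
have zE (p q r s u v : form) :
    r - s + (u - v) = r + p + (q + u) + (- s - q + (- p - v)).
  rewrite -(opprD s) -(opprD p) -opprD (addrACA r p) opprD [RHS]addrACA; congr (_ + _).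
    by rewrite opprD addrACA subrr addr0.
  by rewrite opprD addrACA subrr add0r.
by rewrite !act_coad; exact: zE.
Qed.

(** This sum runs over all pairs of indices and so counts each pair i < j
    twice, and with sign opposite to the Koszul formula: hence the factor
    - 1/2 in diff. *)
Definition diff_bracket w : form := \sum_(i < n) \sum_(j < n)
  ext (lie_bracket b`_i b`_j) (contr j (contr i w)).

Definition diff w : form :=
  \sum_(i < n) act b`_i (contr i w) - 2^-1 *: diff_bracket w.

Lemma diff_linear : linear diff.
Proof.
move=> a u v; rewrite /diff.
have -> : \sum_(i < n) act b`_i (contr i (a *: u + v)) =
    a *: (\sum_(i < n) act b`_i (contr i u)) + \sum_(i < n) act b`_i (contr i v).
  by rewrite scaler_sumr -big_split; apply: eq_bigr => i _; rewrite !linearP.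
have -> : diff_bracket (a *: u + v) = a *: diff_bracket u + diff_bracket v.
  rewrite /diff_bracket scaler_sumr -big_split; apply: eq_bigr => i _ /=.
  by rewrite scaler_sumr -big_split; apply: eq_bigr => j _; rewrite !linearP.
by rewrite scalerBr scalerDr !scalerA mulrC opprD addrACA.
Qed.
HB.instance Definition _ := GRing.isLinear.Build F form form *:%R
  diff diff_linear.

Lemma diff_alt w : alternating w -> alternating (diff w).
Proof.
move=> aw; rewrite /diff -scaleNr; apply: add_alt.
  by apply: sum_alt => i; apply/act_alt/contr_alt.
by apply/scale_alt/sum_alt => i; apply: sum_alt => j; apply/ext_alt/contr_alt/contr_alt.
Qed.

Lemma diff_homog p w : homog p.+1 w -> homog p (diff w).
Proof.
move=> hw; rewrite /diff -scaleNr; apply: add_homog.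
  by apply: sum_homog => i; apply/act_homog/contr_homog.
apply/scale_homog; case: p hw => [|p] hw; apply: sum_homog => i.
  by rewrite big1 // => j _; rewrite (contr_homog0 _ (contr_homog i hw)) linear0.
by apply: sum_homog => j; apply/ext_homog/contr_homog/contr_homog.
Qed.

Lemma diff_homog0 w : homog 0 w -> diff w = 0.
Proof.
move=> hw; rewrite /diff /diff_bracket !big1 ?scaler0 ?subr0 // => i _.
  by rewrite big1 // => j _; rewrite (contr_homog0 i hw) !linear0.
by rewrite contr_homog0 // linear0.
Qed.

Lemma diff_bracket_ext y w :
  diff_bracket (ext y w) = - (2 *: coad y w) - ext y (diff_bracket w).
Proof.
have contr2 i j : contr j (contr i (ext y w)) = coord b i y *: contr j w
    - coord b j y *: contr i w + ext y (contr j (contr i w)).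
  by rewrite !contr_ext linearB linearZ /= contr_ext opprB addrA addrAC.
have term (i j : 'I_n) : ext (lie_bracket b`_i b`_j) (contr j (contr i (ext y w))) =
      coord b i y *: ext_of (contr j w) (lie_bracket b`_i b`_j)
    - coord b j y *: ext_of (contr i w) (lie_bracket b`_i b`_j)
    - ext y (ext (lie_bracket b`_i b`_j) (contr j (contr i w))).
  by rewrite contr2 linearD linearB !linearZ /= ext_ext.
rewrite {1}/diff_bracket.
under eq_bigr => i _.
  under eq_bigr => j _ do rewrite term.
  rewrite !sumrB; over.
rewrite !sumrB scaler_nat mulr2n opprD; congr (_ - _ - _).
- rewrite exchange_big -sumrN; apply: eq_bigr => j _ /=.
  rewrite (basis_expansion (ext_of (contr j w) \o ad b`_j) y) /= /ad lie_bracketC.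
  by rewrite linearN.
- apply: eq_bigr => i _ /=.
  under eq_bigr => j _ do rewrite lie_bracketC linearN scalerN.
  rewrite sumrN (basis_expansion (ext_of (contr i w) \o ad b`_i) y) /= /ad.
  by rewrite lie_bracketC linearN opprK.
- by rewrite linear_sum; apply: eq_bigr => i _; rewrite linear_sum.
Qed.

(** The anticommutation relations leave only the terms in which one contraction
    hits y: rho(y) from the first sum and twice coad y from the second. *)
Lemma cartan y w : diff (ext y w) = theta y w - ext y (diff w).
Proof.
rewrite /diff diff_bracket_ext.
have -> : \sum_(i < n) act b`_i (contr i (ext y w)) =
    act y w - ext y (\sum_(i < n) act b`_i (contr i w)).
  have -> : act y w = \sum_j coord b j y *: act b`_j w.
    exact/esym/(basis_expansion (act_of w)).
  rewrite linear_sum -sumrB; apply: eq_bigr => i _.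
  by rewrite contr_ext linearB linearZ /= act_ext.
have -> : 2^-1 *: (- (2 *: coad y w) - ext y (diff_bracket w)) =
    - coad y w - ext y (2^-1 *: diff_bracket w).
  by rewrite scalerBr scalerN scalerA mulVf ?pnatr_eq0 // scale1r [in RHS]linearZ /=.
rewrite [ext y (_ - _)]linearB /= /theta [RHS]addrAC opprD opprK.
by rewrite opprD !opprK [coad y w + _]addrC !addrA.
Qed.

(** By form_ind it suffices that the commutator of diff and theta x anticommutes
    with ext y. By Cartan's formula, what remains is
    the relation theta_bracket between theta x and theta y. *)
Lemma diff_theta p x w : alternating w -> homog p w ->
  diff (theta x w) = theta x (diff w).
Proof.
move: p w; apply: form_ind => [w hw|a u v Eu Ev|y w aw Ew].
- by rewrite !diff_homog0 ?linear0 //; exact: theta_homog.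
- by rewrite !linearP /= Eu Ev.
have zE (p q r s : form) : r - s - p + (s - q) = r - (p + q).
  by rewrite [r - s - p]addrAC subrKA opprD addrA.
have thB u v : theta x (u - v) = theta x u - theta x v by rewrite linearB.
rewrite theta_ext linearD /= !cartan Ew (thB (theta y w)) theta_ext.
by have /= -> := theta_bracket y x aw; exact: zE.
Qed.

(** coad x is zero in degree 0, and by loc_nilp_shift exterior multiplication
    preserves local nilpotency because ad x is nilpotent. *)
Lemma coad_loc_nilp (C : nat -> gL -> Prop) k x :
    (forall z, C 0 z) -> (forall i z, C i z -> C i.+1 (ad x z)) ->
    (forall z, C k z -> z = 0) ->
  forall p w, alternating w -> homog p w -> loc_nilp (coad x) w.
Proof.
move=> C0 CS Ck; apply: form_ind => [w hw|a u v [m hm] Pv|y w aw Pw].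
- by exists 1%N; exact: coad_homog0.
- apply: loc_nilpD => //; exists m.
  suff -> : iter m (coad x) (a *: u) = a *: iter m (coad x) u by rewrite hm scaler0.
  by elim: m {hm} => //= m ->; rewrite linearZ.
apply: (@loc_nilp_shift _ C (ad x) k CS _ _ (coad x) (coad x) ext _ _ _ 0) => //.
- by move=> z; rewrite linear0.
- by move=> z /Ck -> u; rewrite -[LHS]/(ext_of u 0) linear0.
- by move=> z u /=; rewrite coad_ext addrC.
Qed.
End Forms.

(** * Chains as alternating forms *)
Section Omit.
Variables (F : fieldType) (E : vectType F) (L : lieSubalgebra E).
Local Notation gL := (subvs_of L).

Lemma omit0 p (x : 'I_p -> gL) : omit [::] x = [seq x i | i <- enum 'I_p].
Proof. by rewrite /omit filter_predT. Qed.

Lemma omit_lift p (ks : seq 'I_p) (x : 'I_p.+1 -> gL) :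
  omit (map (lift ord0) ks) x = x ord0 :: omit ks (x \o lift ord0).
Proof.
rewrite /omit enum_ordSl /=.
have -> /= : ord0 \notin map (lift ord0) ks by apply/mapP => -[].
rewrite filter_map -map_comp; congr (_ :: map _ _); apply: eq_filter => i /=.
by rewrite mem_map //; exact: lift_inj.
Qed.

Lemma omit_ord0 p (ks : seq 'I_p) (x : 'I_p.+1 -> gL) :
  omit (ord0 :: map (lift ord0) ks) x = omit ks (x \o lift ord0).
Proof.
rewrite /omit enum_ordSl /=.
rewrite filter_map -map_comp; congr (map _ _); apply: eq_filter => i /=.
by rewrite in_cons /= mem_map //; exact: lift_inj.
Qed.

Lemma omit1 p (x : 'I_p.+1 -> gL) j : omit [:: j] x = omit [::] (x \o lift j).
Proof.
elim: p x j => [|p IH] x j; case: (unliftP ord0 j) => [k ->|->].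
- by case: k.
- exact: (omit_ord0 [::]).
- rewrite (omit_lift [:: k]) IH.
  rewrite [RHS](omit_lift [::]) /=; congr (x _ :: _); first exact: val_inj.
  rewrite !omit0; apply: eq_map => i /=; congr (x _).
  by apply: val_inj; rewrite /= /bump /= !ltnS; case: leqP.
- exact: (omit_ord0 [::]).
Qed.

Lemma size_omit p (ks : seq 'I_p) (x : 'I_p -> gL) :
  uniq ks -> size (omit ks x) = (p - size ks)%N.
Proof.
move=> uks; rewrite size_map size_filter -size_filter.
have -> : [seq i <- enum 'I_p | i \notin ks] = enum (predC (mem ks)).
  by rewrite enumT.
rewrite -cardE; have := cardC (mem ks).
by rewrite (card_uniqP uks) card_ord => E1; rewrite -[LHS](addKn (size ks)) E1.
Qed.
End Omit.

Section Chains.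
Variables (F : numFieldType) (E : vectType F) (L : lieSubalgebra E).
Local Notation gL := (subvs_of L).
Local Notation n := (\dim {:gL}).
Local Notation b := (vbasis {:gL}).
Local Notation form := (seq 'I_n -> E).
Implicit Types (w : form) (t : seq 'I_n).

(** The constant e as a form of degree 0. *)
Definition unit_form (e : E) : form := fun t => if t is [::] then e else 0.

Lemma unit_form_linear : linear unit_form.
Proof. move=> a u v; apply/funext => -[|i t] //.
by rewrite -[RHS]/(a *: 0 + 0) scaler0 addr0. Qed.
HB.instance Definition _ := GRing.isLinear.Build F E form *:%R
  unit_form unit_form_linear.

Definition wedge_form (xs : seq gL) (e : E) : form :=
  foldr (fun x w => ext x w) (unit_form e) xs.

Lemma wedge_form_linear xs : linear (wedge_form xs).
Proof.
by move=> a u v; elim: xs => [|x xs IH] /=; rewrite ?linearP // IH linearP.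
Qed.
HB.instance Definition _ xs := GRing.isLinear.Build F E form *:%R
  (wedge_form xs) (wedge_form_linear xs).

Lemma wedge_form_alt xs e : alternating (wedge_form xs e).
Proof.
elim: xs => [|x xs IH] /=; last exact: ext_alt.
by move=> [|k u] i j t; rewrite /= oppr0.
Qed.

Lemma wedge_form_homog xs e : homog (size xs) (wedge_form xs e).
Proof. by elim: xs => [[]|x xs IH] //=; exact: ext_homog. Qed.

(** The interior product is an antiderivation of degree -1. *)
Lemma contr_wedge_form p (x : 'I_p -> gL) i e :
  contr i (wedge_form (omit [::] x) e) =
    \sum_(k < p) ((-1) ^+ k * coord b i (x k)) *: wedge_form (omit [:: k] x) e.
Proof.
elim: p x => [|p IH] x.
  by rewrite omit0 enum_ord0 big_ord0; apply/funext => -[].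
rewrite (omit_lift [::]) -[LHS]/(contr i (ext _ _)) contr_ext IH big_ord_recl.
rewrite expr0 mul1r (omit_ord0 [::]); congr (_ + _).
rewrite linear_sum -sumrN; apply: eq_bigr => k _.
by rewrite linearZ (omit_lift [:: k]) exprS mulN1r mulNr scaleNr.
Qed.

(** Expansion of the determinant along its first row is the contraction formula
    contr_wedge_form for the first index of the sequence. *)
Lemma det_wedge_form p (u : 'I_p -> 'I_n) (x : 'I_p -> gL) e :
  \det (\matrix_(i, j) coord b (u i) (x j)) *: e =
    wedge_form (omit [::] x) e [seq u i | i <- enum 'I_p].
Proof.
elim: p u x => [|p IH] u x; first by rewrite omit0 enum_ord0 det_mx00 scale1r.
rewrite enum_ordSl /= -[RHS]/(contr _ _ _) contr_wedge_form fct_sumE.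
rewrite (expand_det_row _ ord0) scaler_suml; apply: eq_bigr => j _.
rewrite -[RHS]/(_ *: wedge_form _ e _) omit1 -map_comp.
rewrite -(IH (u \o lift ord0)) scalerA mxE /cofactor add0n mulrCA mulrA.
by congr (_ * \det _ *: _); apply/matrixP => i k; rewrite !mxE.
Qed.

Definition of_form p w : chain L p := [ffun s => w (val (val s))].

Lemma of_form_linear p : linear (of_form p).
Proof. by move=> a u v; apply/ffunP => s; rewrite !ffunE. Qed.
HB.instance Definition _ p := GRing.isLinear.Build F form (chain L p) *:%R
  (of_form p) (of_form_linear p).

Lemma wedgeE p e (xs : seq gL) : size xs = p ->
  wedge p e xs = of_form p (wedge_form xs e).
Proof.
move=> sxs; apply/ffunP => s; rewrite !ffunE.
have xsE : omit [::] (fun j : 'I_p => xs`_j) = xs.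
  rewrite omit0 (map_comp (nth 0 xs) val) val_enum_ord -sxs.
  exact: (mkseq_nth 0).
have -> : val (val s) = [seq tnth (val s) i | i <- enum 'I_p] by rewrite map_tnth_enum.
by rewrite -[in RHS]xsE -det_wedge_form.
Qed.

Definition basis_wedge p (s : multi_index L p) (i : 'I_p) : gL := b`_(tnth (val s) i).

Definition to_form p (c : chain L p) : form :=
  \sum_s wedge_form (omit [::] (basis_wedge s)) (c s).

Lemma to_form_linear p : linear (@to_form p).
Proof.
move=> a u v; rewrite /to_form scaler_sumr -big_split; apply: eq_bigr => s _.
by rewrite !ffunE linearP.
Qed.
HB.instance Definition _ p := GRing.isLinear.Build F (chain L p) form *:%R
  (@to_form p) (@to_form_linear p).

Lemma to_form_alt p (c : chain L p) : alternating (to_form c).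
Proof. by apply: sum_alt => s; exact: wedge_form_alt. Qed.

Lemma to_form_homog p (c : chain L p) : homog p (to_form c).
Proof.
apply: sum_homog => s.
by have := @wedge_form_homog (omit [::] (basis_wedge s)) (c s); rewrite size_omit // subn0.
Qed.

Lemma contr_wedge_notin s i e :
  i \notin s -> contr i (wedge_form [seq b`_(val j) | j <- s] e) = 0.
Proof.
elim: s => [|j s IH] /=; first by move=> _; apply/funext.
rewrite in_cons negb_or => /andP [ij /IH h].
by rewrite contr_ext h linear0 subr0 coord_vbasis_delta eq_sym (negPf ij) scale0r.
Qed.

(** Dual to contr_wedge_notin: multiplying by a basis vector creates only
    coefficients at sequences that contain its index. *)
Lemma ext_notin (i : 'I_n) w t : i \notin t -> ext b`_i w t = 0.
Proof.
elim: t w => [//|j t IH] w; rewrite in_cons negb_or => /andP [ij /IH h] /=.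
by rewrite h coord_vbasis_delta (negPf ij) scale0r subr0.
Qed.

(** If the first indices differ, the smaller one is missing from the other
    sequence altogether, which kills one of the two factors. *)
Lemma wedge_form_basis (s t : seq 'I_n) e :
    sorted ltn (map val s) -> sorted ltn (map val t) ->
  wedge_form [seq b`_(val j) | j <- s] e t = if s == t then e else 0.
Proof.
have notin (i j : 'I_n) (r : seq 'I_n) :
    path ltn (val i) (map val r) -> (j <= i)%N -> j \notin r.
  move=> pr ji; apply/negP => jr.
  have /allP := order_path_min ltn_trans pr.
  by move=> /(_ (val j) (map_f val jr)); rewrite ltnNge ji.
elim: s t => [|i s IH] [|j t] //= ps pt.
rewrite IH ?(path_sorted ps) ?(path_sorted pt) // coord_vbasis_delta eqseq_cons.
case: (ltngtP i j) => [ij|ji|/val_inj <-].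
- rewrite -val_eqE (ltn_eqF ij) /= scale0r sub0r ext_notin ?oppr0 //.
  by apply: notin pt _; exact: ltnW.
- rewrite -val_eqE (gtn_eqF ji) /= scale0r sub0r contr_wedge_notin ?linear0 ?oppr0 //.
  by apply: notin ps _; exact: ltnW.
rewrite eqxx scale1r contr_wedge_notin ?linear0 ?addr0 //.
exact: notin ps (leqnn _).
Qed.

Lemma to_formK p : cancel (@to_form p) (of_form p).
Proof.
move=> c; apply/ffunP => s; rewrite ffunE /to_form fct_sumE (bigD1 s) //=.
have val_at (s' : multi_index L p) : wedge_form (omit [::] (basis_wedge s')) (c s') (val (val s))
    = if s' == s then c s' else 0.
  have -> : omit [::] (basis_wedge s') = [seq b`_(val j) | j <- val (val s')].
    rewrite omit0 /basis_wedge.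
    by rewrite (map_comp (fun j : 'I_n => b`_j) (tnth (val s'))) map_tnth_enum.
  by rewrite wedge_form_basis ?(valP s) ?(valP s').
rewrite val_at eqxx big1 ?addr0 // => s' ss'.
by rewrite val_at (negPf ss').
Qed.

Lemma alternating_perm w s t : alternating w -> perm_eq s t ->
  exists a : bool, w s = (-1) ^+ a *: w t.
Proof.
have move_to i v t' : forall w, alternating w ->
    exists a : bool, w (i :: v ++ t') = (-1) ^+ a *: w (v ++ i :: t').
  elim: v => [|k v IH] w' aw; first by exists false; rewrite scale1r.
  have [a ha] := IH _ (contr_alt k aw); exists (~~ a).
  rewrite -[_ (k :: v) _]/(k :: (v ++ t')) (aw [::]) -[w' _]/(contr k w' (i :: v ++ t')) ha.
  by case: a {ha}; rewrite ?scale1r ?scaleN1r ?opprK.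
elim: s t w => [|i s IH] t w aw.
  by rewrite perm_sym => /perm_nilP ->; exists false; rewrite scale1r.
move=> pst; have it : i \in t by rewrite -(perm_mem pst) mem_head.
case/splitPr: it pst => t1 t2; rewrite perm_sym perm_catC /= perm_cons perm_catC perm_sym.
move=> /(IH _ (contr i w) (contr_alt i aw)) [a].
have [c hc] := move_to i t1 t2 w aw.
rewrite /contr hc scalerA -signr_addb => ->.
by exists (a (+) c).
Qed.

Lemma alternating_repeat w t : alternating w -> ~~ uniq t -> w t = 0.
Proof.
elim: t w => [//|i t IH] w aw /=; rewrite negb_and negbK => /orP [it|].
  have [a ha] := alternating_perm (contr_alt i aw) (perm_to_rem it).
  have /eqP : w [:: i, i & rem i t] = - w [:: i, i & rem i t] by exact: (aw [::]).
  rewrite -addr_eq0 -mulr2n -scaler_nat scaler_eq0 pnatr_eq0 /= => /eqP h.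
  by rewrite -[LHS]/(contr i w t) ha /contr h scaler0.
exact: (IH _ (contr_alt i aw)).
Qed.

(** An alternating form is determined by its values at increasing sequences:
    it vanishes at sequences with repetitions, and sorting the others only
    changes the sign. *)
Lemma of_form_eq0 p w : alternating w -> homog p w -> of_form p w = 0 -> w = 0.
Proof.
move=> aw hw w0; apply/funext => t.
have [st|/hw //] := eqVneq (size t) p.
have [ut|/(alternating_repeat aw) //] := boolP (uniq t).
pose s := sort (relpre val leq) t.
have ps : perm_eq t s by rewrite perm_sym perm_sort.
have [a ->] := alternating_perm aw ps.
have ss : size s == p by rewrite size_sort st.
have sorted_s : sorted ltn (map val (Tuple ss)).
  rewrite ltn_sorted_uniq_leq map_inj_uniq ?sort_uniq ?ut; last exact: val_inj.
  rewrite sorted_map; apply: sort_sorted => i j; exact: leq_total.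
have /ffunP /(_ (Sub (Tuple ss) sorted_s)) := w0.
by rewrite !ffunE /= => ->; rewrite scaler0.
Qed.

Lemma of_formK p w : alternating w -> homog p w -> to_form (of_form p w) = w.
Proof.
move=> aw hw; apply/eqP; rewrite -subr_eq0; apply/eqP; apply: (@of_form_eq0 p).
- by rewrite -scaleN1r; apply/add_alt/scale_alt => //; exact: to_form_alt.
- by rewrite -scaleN1r; apply/add_homog/scale_homog => //; exact: to_form_homog.
- by rewrite linearB /= to_formK subrr.
Qed.

Variable f : dual_lie L.
Lemma act_wedge_form x xs e :
  act f x (wedge_form xs e) = wedge_form xs (shift_act f x e).
Proof.
elim: xs => [|y xs IH] /=; last by rewrite act_ext IH.
by apply/funext => -[|i t] //=; rewrite /act linear0.
Qed.

Lemma coad_wedge_form p (x : 'I_p -> gL) y e :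
  coad y (wedge_form (omit [::] x) e) = \sum_(k < p)
    (-1) ^+ k *: wedge_form (lie_bracket (x k) y :: omit [:: k] x) e.
Proof.
rewrite /coad; under eq_bigr => j _ do rewrite contr_wedge_form linear_sum.
rewrite exchange_big; apply: eq_bigr => k _ /=.
under eq_bigr => j _ do rewrite linearZ /= -scalerA.
rewrite -scaler_sumr; congr (_ *: _).
exact: (basis_expansion (ext_of _ \o ad y)).
Qed.

(** The Koszul formula satisfies the recursion that Cartan's formula gives when
    the first factor is split off: the terms involving the first vector add up
    to its Lie derivative, and the others to minus its product with the
    formula for the remaining vectors. *)
Lemma diff_wedge_form p (x : 'I_p -> gL) e :
  diff f (wedge_form (omit [::] x) e) =
    \sum_(k < p) (-1) ^+ k *: wedge_form (omit [:: k] x) (shift_act f (x k) e)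
  + \sum_(k < p) \sum_(l < p | (k < l)%N) (-1) ^+ (k + l) *:
      wedge_form (lie_bracket (x k) (x l) :: omit [:: k; l] x) e.
Proof.
elim: p x => [|p IH] x.
  rewrite omit0 enum_ord0 !big_ord0 addr0 diff_homog0 //.
  exact: (@wedge_form_homog [::]).
rewrite (omit_lift [::]) -[LHS]/(diff f (ext _ _)) cartan IH /theta.
rewrite act_wedge_form coad_wedge_form linearD /= opprD addrACA.
rewrite !big_ord_recl /= expr0 scale1r (omit_ord0 [::]); congr (_ + _ + (_ + _)).
- rewrite linear_sum -sumrN; apply: eq_bigr => k _.
  by rewrite linearZ (omit_lift [:: k]) exprS mulN1r scaleNr.
- rewrite [RHS]big_mkcond [RHS]big_ord_recl /= add0r; apply: eq_bigr => k _.
  rewrite (omit_ord0 [:: k]) lie_bracketC exprS mulN1r scaleNr -scalerN.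
  by rewrite -[ext (- _) _]/(ext_of _ _) linearN.
rewrite linear_sum -sumrN; apply: eq_bigr => k _ /=.
rewrite linear_sum -sumrN [RHS]big_mkcond [RHS]big_ord_recl /= add0r -big_mkcond /=.
apply: eq_bigr => l _; rewrite linearZ (omit_lift [:: k; l]) /= ext_ext scalerN opprK.
by rewrite /bump /= addSn addnS !exprS !mulN1r opprK.
Qed.

Lemma koszul_wedgeE p e (x : 'I_p.+1 -> gL) :
  koszul_wedge f e x = of_form p (diff f (wedge_form (omit [::] x) e)).
Proof.
rewrite diff_wedge_form linearD !linear_sum /=; congr (_ + _).
  apply: eq_bigr => k _; rewrite wedgeE ?size_omit ?subn1 // -shift_actE.
  by rewrite [RHS]linearZ.
apply: eq_bigr => k _; rewrite linear_sum; apply: eq_bigr => l kl.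
rewrite [RHS]linearZ wedgeE //= size_omit /= ?inE ?andbT.
  rewrite subSS subn1 prednK //.
  by apply: leq_ltn_trans (leq0n k) (leq_trans kl _); rewrite -ltnS.
by rewrite -val_eqE (ltn_eqF kl).
Qed.

Lemma koszul_funE p (c : chain L p.+1) :
  koszul_fun f c = of_form p (diff f (to_form c)).
Proof.
rewrite /koszul_fun /to_form !linear_sum; apply: eq_bigr => s _.
exact: koszul_wedgeE.
Qed.

Lemma koszul_fun_linear p : linear (@koszul_fun _ _ _ f p).
Proof. by move=> a u v; rewrite !koszul_funE !linearP. Qed.
HB.instance Definition _ p := GRing.isLinear.Build F (chain L p.+1) (chain L p) *:%R
  (@koszul_fun _ _ _ f p) (@koszul_fun_linear p).

Lemma to_form_koszul p (c : chain L p.+1) :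
  to_form (koszul f p.+1 c) = diff f (to_form c).
Proof.
rewrite lfunE /= koszul_funE of_formK //.
  by apply: diff_alt; exact: to_form_alt.
by apply: diff_homog; exact: to_form_homog.
Qed.

(** Also valid in degree 0, where both differentials vanish. *)
Lemma koszul_ker p (c : chain L p) :
  (c \in lker (koszul f p)) = (diff f (to_form c) == 0).
Proof.
rewrite memv_ker; case: p c => [|p] c.
  by rewrite zero_lfunE diff_homog0 ?eqxx //; exact: to_form_homog.
rewrite -to_form_koszul; apply/eqP/eqP => [->|h]; first by rewrite linear0.
by rewrite -[LHS]to_formK h linear0.
Qed.
End Chains.

(** * The lower central series of L *)
Section CentralSeries.
Variables (F : fieldType) (E : vectType F) (L : lieSubalgebra E).

Lemma op_bracketE (x y : 'End(E)) e : op_bracket x y e = y (x e) - x (y e).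
Proof. by rewrite add_lfunE opp_lfunE !comp_lfunE. Qed.

Lemma op_bracketC (x y : 'End(E)) : op_bracket x y = - op_bracket y x.
Proof. by rewrite /op_bracket opprB. Qed.

Definition op_ad (y x : 'End(E)) := op_bracket x y.

Lemma op_ad_linear y : linear (op_ad y).
Proof.
move=> a u v; apply/lfunP => e.
rewrite /op_ad op_bracketE [RHS]add_lfunE [in RHS]scale_lfunE !op_bracketE !add_lfunE !scale_lfunE.
by rewrite linearP /= scalerBr opprD addrACA.
Qed.
HB.instance Definition _ y := GRing.isLinear.Build F 'End(E) 'End(E) *:%R
  (op_ad y) (op_ad_linear y).

Lemma op_bracket_memv (U V : {vspace 'End(E)}) x y :
  x \in U -> y \in V -> op_bracket x y \in bracketv U V.
Proof.
move=> xU yV; rewrite -[op_bracket x y]/(op_ad y x) (coord_vbasis xU) linear_sum.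
apply: memv_suml => i _; rewrite linearZ memvZ //= /op_ad op_bracketC memvN.
rewrite -[op_bracket y _]/(op_ad _ y) (coord_vbasis yV) linear_sum.
apply: memv_suml => j _; rewrite linearZ memvZ //= /op_ad op_bracketC memvN.
by apply/memv_span/allpairs_f; rewrite mem_nth ?size_tuple.
Qed.

Definition lower_central i (z : subvs_of L) : Prop :=
  vsval z \in iter i (bracketv L) L.

Lemma lower_central0 z : lower_central 0 z.
Proof. exact: subvsP. Qed.

Lemma lower_centralS i z x :
  lower_central i z -> lower_central i.+1 (lie_bracket z x).
Proof.
rewrite /lower_central lie_bracketC linearN memvN /= => zi.
exact: op_bracket_memv (subvsP x) zi.
Qed.

Lemma lower_central_end k z :
  iter k (bracketv L) L = 0%VS -> lower_central k z -> z = 0.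
Proof.
by rewrite /lower_central => ->; rewrite memv0 => /eqP z0; apply/val_inj.
Qed.
End CentralSeries.

(** * Weights and homology *)
Section Spectrum.
Variables (F : numFieldType) (E : vectType F) (L : lieSubalgebra E).
Variable f : dual_lie L.

Lemma homology_neq0P p : (exists h : homology f p, h != 0) <->
  exists z, z \in lker (koszul f p) /\ z \notin limg (koszul f p.+1).
Proof.
pose I := boundary_zmodClosed f p.
have pi0 (z : subvs_of (lker (koszul f p))) :
    (\pi_(homology f p)%qT z == 0 :> homology f p)
      = (vsval z \in limg (koszul f p.+1)).
  rewrite -[0](raddf0 (\pi_(homology f p)%qT)).
  have /= <- := Quotient.idealrBE I z 0.
  by rewrite subr0.
split=> [[h]|[z [zk zB]]].
  rewrite -[h]reprK pi0 => hB; exists (vsval (repr h)); split=> //; exact: subvsP.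
by exists (\pi_(homology f p)%qT (Subvs zk)); rewrite pi0.
Qed.

Hypothesis nilL : nilpotent_lie L.

Section Character.
Hypothesis hf : lie_character f.

Definition theta_chain p x : 'End(chain L p) :=
  linfun (@of_form F E L p \o theta f x \o @to_form F E L p).

Lemma to_form_theta p x c : to_form (theta_chain p x c) = theta f x (to_form c).
Proof.
rewrite lfunE /= of_formK //.
  by apply: theta_alt; exact: to_form_alt.
by apply: theta_homog; exact: to_form_homog.
Qed.

Lemma theta_chain_bracket p x y c : theta_chain p (lie_bracket x y) c =
  theta_chain p y (theta_chain p x c) - theta_chain p x (theta_chain p y c).
Proof.
apply: (can_inj (@to_formK F E L p)); rewrite linearB /= !to_form_theta.
by rewrite (theta_bracket hf) //; exact: to_form_alt.
Qed.

Lemma theta_chain0 p : theta_chain p 0 = 0.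
Proof.
apply/lfunP => c; apply: (can_inj (@to_formK F E L p)).
rewrite to_form_theta zero_lfunE linear0 /theta -[act _ _ _]/(act_of f _ 0) linear0.
rewrite add0r /coad big1 // => j _; rewrite /ad lie_bracketC -[lie_bracket _ _]/(ad _ 0).
by rewrite linear0 oppr0 -[ext _ _]/(ext_of _ 0) linear0.
Qed.

(** The engine is applied to the chains of degree p with the action theta, the
    cycles as Z and the boundaries as B; Cartan's formula says that theta x
    maps a cycle c to the boundary of x /\ c. *)
Lemma homology_weight p (h : homology f p) : h != 0 -> lie_weight f.
Proof.
move=> h0; have [z [zk zB]] : exists z,
    z \in lker (koszul f p) /\ z \notin limg (koszul f p.+1).
  by apply/homology_neq0P; exists h.
have [k Lk] := nilL.
have CS := @lower_centralS _ _ L; have C0 := @lower_central0 _ _ L.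
have Ck z' := @lower_central_end _ _ L k z' Lk.
have rhoC y : lower_central k y -> theta_chain p y = 0.
  by move/Ck => ->; exact: theta_chain0.
have Zst : stable (theta_chain p) (lker (koszul f p)).
  move=> x c; rewrite !koszul_ker to_form_theta => /eqP dc.
  rewrite (diff_theta hf _ (to_form_alt c) (to_form_homog c)) dc.
  by rewrite linear0.
have ZB x : {in lker (koszul f p), forall c, theta_chain p x c \in limg (koszul f p.+1)}.
  move=> c; rewrite koszul_ker => /eqP dc.
  have -> : theta_chain p x c = koszul f p.+1 (of_form p.+1 (ext x (to_form c))).
    apply: (can_inj (@to_formK F E L p)); rewrite to_form_theta to_form_koszul // of_formK.
    - by rewrite cartan dc linear0 subr0.
    - by apply/ext_alt/to_form_alt.
    - by apply/ext_homog/to_form_homog.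
  by rewrite memv_img ?memvf.
have [c c0 cinv] :=
  trivial_subquotient_invariant C0 CS (@theta_chain_bracket p) rhoC Zst ZB zk zB.
have w0 : to_form c != 0 by rewrite -(inj_eq (can_inj (@to_formK _ _ _ p))) linear0 in c0.
have [t wt] : exists t, to_form c t != 0.
  apply: contrapT => h'; case/eqP: w0; apply/funext => t; apply/eqP/negPn/negP => ht.
  by apply: h'; exists t.
exists (to_form c t) => // x.
have [m hm] : loc_nilp (coad x) (to_form c).
  apply: (@coad_loc_nilp _ _ _ (@lower_central _ _ L) k x C0 _ Ck p).
  - by move=> i y; exact: CS.
  - exact: to_form_alt.
  - exact: to_form_homog.
exists m.
have actE i : iter i (act f x) (to_form c) = (-1) ^+ i *: iter i (coad x) (to_form c).
  elim: i => [|i IH]; first by rewrite scale1r.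
  have actc : act f x (to_form c) = - coad x (to_form c).
    apply/eqP; rewrite -addr_eq0 -[_ + _]/(theta f x (to_form c)).
    by rewrite -to_form_theta cinv linear0.
  have actD : act f x (iter i (coad x) (to_form c)) = - iter i.+1 (coad x) (to_form c).
    by elim: i {IH} => //= i IHi; rewrite act_coad IHi linearN.
  by rewrite [LHS]iterS IH linearZ /= actD scalerN exprS mulN1r scaleNr.
have := congr1 (fun w => w t) (actE m); rewrite hm scaler0 => h1.
rewrite -[RHS]h1; elim: (m) => //= i ->; rewrite /act shift_actE.
by [].
Qed.
End Character.


(** The sign makes the dual of a representation a representation for the same
    bracket. *)
Definition dual_act (g : 'End(E)) (l : 'Hom(E, F^o)) : 'Hom(E, F^o) :=
  - (l \o g)%VF.

Lemma dual_actE g l e : dual_act g l e = - l (g e).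
Proof. by rewrite opp_lfunE comp_lfunE. Qed.

Lemma dual_act_linear g : linear (dual_act g).
Proof.
move=> a l m; apply/lfunP => e.
by rewrite add_lfunE scale_lfunE !dual_actE add_lfunE scale_lfunE opprD scalerN.
Qed.
HB.instance Definition _ g := GRing.isLinear.Build F 'Hom(E, F^o) 'Hom(E, F^o) *:%R
  (dual_act g) (dual_act_linear g).

Lemma separating_form (v : E) : v != 0 -> exists l : 'Hom(E, F^o), l v != 0.
Proof.
move=> v0; apply: contrapT => h; case/eqP: v0.
rewrite (coord_vbasis (memvf v)) big1 // => i _.
suff -> : coord (vbasis {:E}) i v = 0 by rewrite scale0r.
apply/eqP/negPn/negP => ci; apply: h.
by exists (linfun (coord (vbasis {:E}) i : {linear E -> F^o})); rewrite lfunE.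
Qed.

Lemma shift_act0 : shift_act f 0 = 0.
Proof. by apply/lfunP => e; rewrite shift_actE !linear0 zero_lfunE scale0r subr0. Qed.

(** In the dual of E, the forms vanishing at the invariant vector v are a
    proper subspace that contains the image of every element of L: a subquotient
    of the dual on which L acts trivially. *)
Lemma invariant_form (v : E) : lie_character f -> v != 0 ->
    (forall x : subvs_of L, shift_act f x v = 0) ->
  exists2 l : 'Hom(E, F^o), l != 0 & forall (x : subvs_of L) e, l (shift_act f x e) = 0.
Proof.
move=> hf v0 vinv; have [k Lk] := nilL.
pose sigma x : 'End('Hom(E, F^o)) := linfun (dual_act (shift_act f x)).
have sigmaE x l e : sigma x l e = - l (shift_act f x e) by rewrite lfunE dual_actE.
have sigma_br x y l :
    sigma (lie_bracket x y) l = sigma y (sigma x l) - sigma x (sigma y l).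
  apply/lfunP => e; rewrite add_lfunE opp_lfunE !sigmaE !opprK.
  rewrite shift_actE lie_bracketE hf scale0r subr0 -(shiftv_comm _ _ (f y) (f x)).
  by rewrite linearB opprB.
have sigmaC z : lower_central k z -> sigma z = 0.
  move/(lower_central_end Lk) => ->; apply/lfunP => l; apply/lfunP => e.
  by rewrite sigmaE shift_act0 !zero_lfunE linear0 oppr0.
have ev_linear : linear (fun l : 'Hom(E, F^o) => l v).
  by move=> a l m; rewrite add_lfunE scale_lfunE.
pose evL : {linear 'Hom(E, F^o) -> F^o} := HB.pack (fun l : 'Hom(E, F^o) => l v)
  (GRing.isLinear.Build _ _ _ _ _ ev_linear).
have kerE l : (l \in lker (linfun evL)) = (l v == 0) by rewrite memv_ker lfunE.
have [l lv] := separating_form v0.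
have st : stable sigma fullv by move=> x m _; exact: memvf.
have evB x : {in fullv, forall m, sigma x m \in lker (linfun evL)}.
  by move=> m _; rewrite kerE sigmaE vinv linear0 oppr0.
have lB : l \notin lker (linfun evL) by rewrite kerE.
have [m m0 minv] := trivial_subquotient_invariant (@lower_central0 _ _ L)
  (@lower_centralS _ _ L) sigma_br sigmaC st evB (memvf l) lB.
exists m => // x e; apply/eqP; rewrite -oppr_eq0 -sigmaE minv.
by rewrite zero_lfunE.
Qed.

(** An invariant form l vanishes on the boundaries of degree 0, whose
    values lie in rho(L) E; so the constant chain e is not a boundary as soon as
    l e <> 0. *)
Lemma weight_spectrum : lie_weight f -> joint_spectrum L f.
Proof.
move=> [v0 v00 wt]; have [k Lk] := nilL.
have CS := @lower_centralS _ _ L; have C0 := @lower_central0 _ _ L.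
have Ck z' := @lower_central_end _ _ L k z' Lk.
have rhoC (z : subvs_of L) : lower_central k z -> vsval z = 0 by move/Ck => ->; rewrite linear0.
have alphaC (z : subvs_of L) : lower_central k z -> f z = 0 by move/Ck => ->; rewrite linear0.
have [v vn0 eig] : exists2 v : E, v != 0 & forall x : subvs_of L, vsval x v = f x *: v.
  apply: (weight_eigenvector C0 CS (@lie_bracketE _ _ L) rhoC alphaC v00) => x.
  have [m hm] := wt x; exists m; rewrite -[RHS]hm.
  by elim: m {hm} => //= m ->; rewrite shiftvE.
have hf : lie_character f.
  move=> x y; apply/eqP; have := eig (lie_bracket x y).
  have vZ (z : subvs_of L) c u : vsval z (c *: u) = c *: vsval z u by rewrite linearZ.
  rewrite lie_bracketE !eig !vZ !eig !scalerA [f y * f x]mulrC subrr => /esym/eqP.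
  by rewrite scaler_eq0 (negPf vn0) orbF.
have vinv x : shift_act f x v = 0 by rewrite shift_actE eig subrr.
have [l l0 lE] := invariant_form hf vn0 vinv.
have [e le] : exists e, l e != 0.
  apply: contrapT => h; case/eqP: l0; apply/lfunP => e; rewrite zero_lfunE.
  by apply/eqP/negPn/negP => he; apply: h; exists e.
split=> //; exists 0%N; apply/homology_neq0P.
exists [ffun=> e]; split; first by rewrite memv_ker zero_lfunE.
apply/negP => /memv_imgP [c _ ce].
have s0 : multi_index L 0 by exists [tuple].
have := congr1 (fun c : chain L 0 => l (c s0)) ce.
rewrite ffunE lfunE /= => /eqP; rewrite (_ : l (koszul_fun f c s0) = 0) ?(negPf le) //.
rewrite /koszul_fun sum_ffunE linear_sum big1 // => s _.
rewrite /koszul_wedge !big_ord_recl !big_ord0 /= big_mkcond big_ord_recl big_ord0 /=.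
rewrite !addr0 expr0 scale1r ffunE linearZ /=.
by rewrite -shift_actE lE scaler0.
Qed.
End Spectrum.

Theorem theorem3p2 (R : realType) (E : vectType R[i]) (L : lieSubalgebra E)
    (nilL : nilpotent_lie L) :
  joint_spectrum L = [set alpha : dual_lie L | lie_weight alpha]%classic.
Proof.
apply/seteqP; split=> f /=; last exact: weight_spectrum.
by case=> hf [p [h h0]]; exact: homology_weight h0.
Qed.
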